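(* Let $\mathcal{Q}\subset\mathbb{R}^{n_u}$ be convex, and let $f$ be a real-valued function that is twice continuously differentiable on $\mathcal{Q}$ and whose gradient is Lipschitz continuous on $\mathcal{Q}$ with constant $L\ge 0$. Let $\mathcal{U}=\{u_0,u_1,\dots,u_{n_u}\}\subset\mathcal{Q}$ be poised for linear interpolation in $\mathbb{R}^{n_u}$, that is, the matrix $U=[\,u_1-u_0,\ \dots,\ u_{n_u}-u_0\,]\in\mathbb{R}^{n_u\times n_u}$ is nonsingular. Then the error norm of the noise-free simplex gradient $g_t$ satisfies $$\|g_t-\nabla f(u_0)\|\le T_c\le T_d,$$ where $T_c=T_d$ if and only if the points $u_j$, for $j=1,\dots,n_u$, are all equally distant from $u_0$.
   Context: $\|\cdot\|$ denotes the Euclidean norm of a vector (row or column), or the spectral norm of a matrix (the norm induced by the Euclidean norm). Vectors $u_j\in\mathbb{R}^{n_u}$ are column vectors and gradients are column vectors. The gradient $\nabla f$ is Lipschitz continuous on $\mathcal{Q}$ with constant $L\ge 0$ if $\|\nabla f(a)-\nabla f(b)\|\le L\|a-b\|$ for all $a,b\in\mathcal{Q}$. The noise-free simplex gradient is $$g_t=(U^{-1})^{\mathsf T}\bigl[f(u_1)-f(u_0),\ \dots,\ f(u_{n_u})-f(u_0)\bigr]^{\mathsf T}.$$ The square column bound is $$T_c=\frac{L}{2}\,\Bigl\|\bigl[\,(u_1-u_0)^{\mathsf T}(u_1-u_0),\ \dots,\ (u_{n_u}-u_0)^{\mathsf T}(u_{n_u}-u_0)\,\bigr]\Bigr\|\,\|U^{-1}\|.$$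 The delta bound is $$T_d=\|\hat U^{-1}\|\,\sqrt{n_u}\,\frac{L}{2}\,\Delta,\qquad \Delta=\max_{u_j\in\mathcal{U}}\|u_j-u_0\|,\qquad \hat U=\frac1\Delta U.$$
   Formalization: The implication from T_c = T_d to all points being equally distant from u_0 is stated only for L > 0: for L = 0 both bounds vanish for any points (e.g. f = 0, u_0 = 0, u_1 = e_1, u_2 = 2e_2), so it fails. The rest is proved for all L ≥ 0. *)

(* Defs.v *)
From mathcomp Require Import all_boot all_order all_algebra.
From mathcomp Require Import all_classical all_reals all_analysis.

Set Implicit Arguments.
Unset Strict Implicit.
Unset Printing Implicit Defensive.

Import Order.TTheory GRing.Theory Num.Theory.
Import numFieldNormedType.Exports.

Local Open Scope classical_set_scope.
Local Open Scope ring_scope.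

(* The library norm `|v| on 'M[R]_(m, n) is the max norm; it induces the same
   topology, hence the same differentials, but the error bounds are stated for
   the Euclidean norm.  [enorm] is only applied to rows and columns. *)
Definition enorm (R : realType) (m n : nat) (v : 'M[R]_(m, n)) : R :=
  Num.sqrt (\sum_i \sum_j v i j ^+ 2).

Definition spectral_norm (R : realType) (m n : nat) (A : 'M[R]_(m, n)) : R :=
  sup [set enorm (A *m x) | x in [set x : 'cV[R]_n | enorm x <= 1]].

(* Q is an arbitrary convex set, so the derivatives are taken relative to Q:
   the increments y - x range over the y in Q only.  At an interior point of Q
   this is the usual notion, and only the values of f on Q matter.  Linearity of df is not
   required here, but [has_diff_within] is only used with matrix products. *)
Definition has_diff_within (R : realType) (V W : normedModType R) (Q : set V)
    (f : V -> W) (x : V) (df : V -> W) : Prop :=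
  forall y, f y - f x - df (y - x) =o_(y \near within Q (nbhs x)) (y - x).

Definition has_gradient_within (R : realType) (n : nat) (Q : set 'cV[R]_n)
    (f : 'cV[R]_n -> R) (x g : 'cV[R]_n) : Prop :=
  has_diff_within Q (f : _ -> R^o) x (fun h => (g^T *m h) 0 0).

(* The gradient at a point x of a convex set Q with nonempty interior is unique
   when it exists; every Q containing n + 1 affinely independent points is of
   this kind. *)
Definition gradient (R : realType) (n : nat) (Q : set 'cV[R]_n)
    (f : 'cV[R]_n -> R) (x : 'cV[R]_n) : 'cV[R]_n :=
  get [set g | has_gradient_within Q f x g].

Definition twice_continuously_differentiable_on (R : realType) (n : nat)
    (Q : set 'cV[R]_n) (f : 'cV[R]_n -> R) : Prop :=
  (forall x, Q x -> exists g, has_gradient_within Q f x g) /\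
  exists H : 'cV[R]_n -> 'M[R]_n,
    (forall x, Q x -> has_diff_within Q (gradient Q f) x (fun h => H x *m h)) /\
    {within Q, continuous H}.

Definition lipschitz_gradient_on (R : realType) (n : nat) (Q : set 'cV[R]_n)
    (f : 'cV[R]_n -> R) (L : R) : Prop :=
  forall a b, Q a -> Q b ->
    enorm (gradient Q f a - gradient Q f b) <= L * enorm (a - b).

(* The points are u ord0, the base point, and u (lift ord0 j) for j : 'I_n. *)
Section SimplexGradient.
Variables (R : realType) (n : nat) (u : 'I_n.+1 -> 'cV[R]_n).

Definition simplex_matrix : 'M[R]_n :=
  \matrix_(i, j) (u (lift ord0 j) - u ord0) i 0.

Definition poised : Prop := simplex_matrix \in unitmx.

Definition simplex_gradient (f : 'cV[R]_n -> R) : 'cV[R]_n :=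
  (invmx simplex_matrix)^T *m (\row_j (f (u (lift ord0 j)) - f (u ord0)))^T.

Definition square_column_bound (L : R) : R :=
  L / 2 *
  enorm (\row_j ((u (lift ord0 j) - u ord0)^T *m (u (lift ord0 j) - u ord0)) 0 0)
  * spectral_norm (invmx simplex_matrix).

Definition radius : R := \big[Num.max/0]_(j < n.+1) enorm (u j - u ord0).

Definition scaled_simplex_matrix : 'M[R]_n := radius^-1 *: simplex_matrix.

Definition delta_bound (L : R) : R :=
  spectral_norm (invmx scaled_simplex_matrix) * Num.sqrt n%:R * (L / 2) * radius.

Definition equally_distant : Prop :=
  forall j k : 'I_n,
    enorm (u (lift ord0 j) - u ord0) = enorm (u (lift ord0 k) - u ord0).

End SimplexGradient.

(* Main.v *)
Require Import Defs.
From mathcomp Require Import all_boot all_order all_algebra.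
From mathcomp Require Import all_classical all_reals all_analysis.
From mathcomp Require Import ring lra.

Set Implicit Arguments.
Unset Strict Implicit.
Unset Printing Implicit Defensive.

Import Order.TTheory GRing.Theory Num.Theory.
Import numFieldNormedType.Exports.

Local Open Scope classical_set_scope.
Local Open Scope ring_scope.

(** The error bound reduces to one-dimensional calculus on each segment from
    [u_0] to [u_j].  Write [h_j = u_j - u_0].  The vector
    [U^T (g_t - grad f u_0)] has entries [f u_j - f u_0 - <grad f u_0, h_j>],
    the linearization errors of [f] at [u_0], and Taylor's inequality
    ([taylor_bound]) bounds each of them by [L / 2 * |h_j|^2].  Applying
    [U^-T] costs at most the factor [|U^-1|], since a matrix and its transpose
    have the same spectral norm ([enorm_trmx_mulmx_le]); this is
    [simplex_gradient_error].

    Taylor's inequality needs no integral.  Convexity puts the whole segment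
    inside [Q], so [f] restricted to it is a function [p] on [0, 1] that is
    differentiable in the usual sense at interior points and continuous at the
    endpoints, even though the derivatives of [f] are only taken relative to
    [Q].  The mean value theorem applied to [p t + a t^2] for
    [a = K / 2] and [a = - K / 2] with [K = L |h|^2] then gives both sides of
    the bound ([taylor_bound01]).

    To compare the two bounds, scaling gives [|(U / Delta)^-1| = Delta |U^-1|],
    so both are [L / 2 * |U^-1|] times a factor: the norm of the vector of the
    [|h_j|^2] for one, and [sqrt n * Delta^2] for the other.  The latter is the
    norm of the constant vector [Delta^2], which dominates the former entry by
    entry, so the two agree exactly when every [|h_j|] equals [Delta]
    ([enorm_squared_distances]).  Reading this off from the equality of the two
    bounds means cancelling [L / 2 * |U^-1|], which is positive when [L] is; for
    [L = 0] both bounds vanish. *)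

(** * Euclidean and spectral norms *)

Lemma enorm_ge0 (R : realType) (m n : nat) (v : 'M[R]_(m, n)) : 0 <= enorm v.
Proof. exact: sqrtr_ge0. Qed.

Lemma enorm_sqr (R : realType) (m n : nat) (v : 'M[R]_(m, n)) :
  enorm v ^+ 2 = \sum_i \sum_j v i j ^+ 2.
Proof.
rewrite sqr_sqrtr// sumr_ge0// => i _.
by apply: sumr_ge0 => j _; exact: sqr_ge0.
Qed.

Lemma enorm_sqr_col (R : realType) (n : nat) (v : 'cV[R]_n) :
  enorm v ^+ 2 = (v^T *m v) 0 0.
Proof.
by rewrite enorm_sqr mxE; apply: eq_bigr => i _; rewrite big_ord1 mxE expr2.
Qed.

Lemma ler_enorm (R : realType) (m n : nat) (v w : 'M[R]_(m, n)) :
  (forall i j, `|v i j| <= w i j) -> enorm v <= enorm w.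
Proof.
move=> vw; apply: ler_wsqrtr; apply: ler_sum => i _; apply: ler_sum => j _.
by rewrite -real_normK ?num_real// ler_sqr ?nnegrE ?(le_trans _ (vw i j)).
Qed.

Lemma enorm_tr (R : realType) (m n : nat) (v : 'M[R]_(m, n)) :
  enorm v^T = enorm v.
Proof.
congr Num.sqrt; rewrite exchange_big.
by apply: eq_bigr => i _; apply: eq_bigr => j _; rewrite mxE.
Qed.

Lemma enormZ (R : realType) (m n : nat) (a : R) (v : 'M[R]_(m, n)) :
  enorm (a *: v) = `|a| * enorm v.
Proof.
rewrite /enorm -sqrtr_sqr -sqrtrM ?sqr_ge0//; congr Num.sqrt.
rewrite mulr_sumr; apply: eq_bigr => i _; rewrite mulr_sumr.
by apply: eq_bigr => j _; rewrite mxE exprMn.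
Qed.

Lemma enorm_eq0 (R : realType) (m n : nat) (v : 'M[R]_(m, n)) :
  (enorm v == 0) = (v == 0).
Proof.
apply/eqP/eqP => [v0|->]; last first.
  rewrite /enorm big1 ?sqrtr0// => i _.
  by rewrite big1// => j _; rewrite mxE expr0n.
have ge0 i : 0 <= \sum_j v i j ^+ 2 by apply: sumr_ge0 => j _; exact: sqr_ge0.
have /eqP := enorm_sqr v.
rewrite v0 expr0n eq_sym psumr_eq0// => /allP vi0.
apply/matrixP => i j; rewrite mxE.
have := vi0 i (mem_index_enum _).
rewrite /= psumr_eq0 => [/allP/(_ j (mem_index_enum _))|k _]; last first.
  exact: sqr_ge0.
by rewrite /= sqrf_eq0 => /eqP.
Qed.

Lemma enorm0 (R : realType) (m n : nat) : enorm (0 : 'M[R]_(m, n)) = 0.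
Proof. by apply/eqP; rewrite enorm_eq0. Qed.

(** With [b = |y|^2] and [c = <x, y>], the squared norm of [b x - c y] equals
    [b (|x|^2 b - c^2)]; its nonnegativity is the inequality. *)
Lemma cauchy_schwarz (R : realType) (n : nat) (x y : 'cV[R]_n) :
  `|(x^T *m y) 0 0| <= enorm x * enorm y.
Proof.
rewrite -ler_sqr ?nnegrE ?mulr_ge0 ?enorm_ge0// real_normK ?num_real//.
have [->|y0] := eqVneq y 0.
  by rewrite mulmx0 mxE expr0n/= sqr_ge0.
rewrite exprMn; set c := (x^T *m y) 0 0.
set a := enorm x ^+ 2; set b := enorm y ^+ 2.
have b0 : 0 < b by rewrite exprn_gt0// lt_def enorm_ge0 enorm_eq0 y0.
have aE : a = \sum_i x i 0 ^+ 2.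
  by rewrite /a enorm_sqr; apply: eq_bigr => i _; rewrite big_ord1.
have bE : b = \sum_i y i 0 ^+ 2.
  by rewrite /b enorm_sqr; apply: eq_bigr => i _; rewrite big_ord1.
have cE : c = \sum_i x i 0 * y i 0.
  by rewrite /c mxE; apply: eq_bigr => i _; rewrite mxE.
have : 0 <= \sum_i (b * x i 0 - c * y i 0) ^+ 2.
  by apply: sumr_ge0 => i _; exact: sqr_ge0.
have -> : \sum_i (b * x i 0 - c * y i 0) ^+ 2 = b * (a * b - c ^+ 2).
  transitivity (b ^+ 2 * a + (- 2 * b * c) * c + c ^+ 2 * b); last by ring.
  rewrite [X in _ * X + _ + _]aE [X in _ + _ * X + _]cE [X in _ + _ * X]bE.
  rewrite !mulr_sumr -!big_split/=.
  by apply: eq_bigr => i _; ring.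
by rewrite pmulr_rge0// subr_ge0.
Qed.

Lemma enorm_mulmx_frobenius (R : realType) (m n : nat) (A : 'M[R]_(m, n))
    (x : 'cV[R]_n) : enorm (A *m x) <= enorm A * enorm x.
Proof.
rewrite -ler_sqr ?nnegrE ?mulr_ge0 ?enorm_ge0// exprMn !enorm_sqr.
rewrite -(enorm_sqr x) mulr_suml; apply: ler_sum => i _.
rewrite big_ord1.
have -> : \sum_j A i j ^+ 2 = enorm (row i A)^T ^+ 2.
  by rewrite enorm_tr enorm_sqr big_ord1; apply: eq_bigr => j _; rewrite mxE.
rewrite -exprMn -real_normK ?num_real// ler_sqr ?nnegrE ?mulr_ge0 ?enorm_ge0//.
by have := cauchy_schwarz (row i A)^T x; rewrite trmxK -row_mul mxE.
Qed.

(** The Frobenius norm bounds the set whose supremum is the spectral norm, so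
    that supremum is finite. *)
Lemma spectral_norm_ub (R : realType) (m n : nat) (A : 'M[R]_(m, n))
    (x : 'cV[R]_n) : enorm x <= 1 -> enorm (A *m x) <= spectral_norm A.
Proof.
move=> x1; apply: ub_le_sup; last by exists x.
exists (enorm A) => _ [y y1 <-].
by rewrite (le_trans (enorm_mulmx_frobenius A y))// ler_piMr ?enorm_ge0.
Qed.

Lemma spectral_norm_ge0 (R : realType) (m n : nat) (A : 'M[R]_(m, n)) :
  0 <= spectral_norm A.
Proof.
apply: le_trans (enorm_ge0 (A *m (0 : 'cV_n))) _.
by rewrite spectral_norm_ub// enorm0 ler01.
Qed.

Lemma enorm_mulmx_le (R : realType) (m n : nat) (A : 'M[R]_(m, n))
    (x : 'cV[R]_n) : enorm (A *m x) <= spectral_norm A * enorm x.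
Proof.
have [->|x0] := eqVneq x 0.
  by rewrite mulmx0 !enorm0 mulr0.
have x_gt0 : 0 < enorm x by rewrite lt_def enorm_eq0 x0 enorm_ge0.
rewrite -ler_pdivrMr// mulrC.
have -> : (enorm x)^-1 * enorm (A *m x) = enorm (A *m ((enorm x)^-1 *: x)).
  by rewrite -scalemxAr enormZ ger0_norm// invr_ge0 enorm_ge0.
apply: spectral_norm_ub.
by rewrite enormZ ger0_norm ?invr_ge0 ?enorm_ge0// mulVf// gt_eqF.
Qed.

Lemma spectral_norm_le (R : realType) (m n : nat) (A : 'M[R]_(m, n)) (K : R) :
  0 <= K -> (forall x : 'cV_n, enorm (A *m x) <= K * enorm x) ->
  spectral_norm A <= K.
Proof.
move=> K0 AK; apply: ge_sup.
  by exists (enorm (A *m (0 : 'cV_n))); exists 0 => //=; rewrite enorm0.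
by move=> _ [x x1 <-]; rewrite (le_trans (AK x))// ler_piMr.
Qed.

Lemma spectral_norm_gt0 (R : realType) (m n : nat) (A : 'M[R]_(m, n))
    (x : 'cV[R]_n) : A *m x != 0 -> 0 < spectral_norm A.
Proof.
move=> Ax.
have Ax_gt0 : 0 < enorm (A *m x) by rewrite lt_def enorm_eq0 Ax enorm_ge0.
rewrite ltNge; apply/negP => A0.
have := lt_le_trans Ax_gt0 (enorm_mulmx_le A x).
by rewrite ltNge mulr_le0_ge0 ?enorm_ge0.
Qed.

(** Since [A = a^-1 (a A)], the reverse of the inequality [|a A| <= a |A|] is
    that inequality itself for the scalar [a^-1]. *)
Lemma spectral_normZ (R : realType) (m n : nat) (a : R) (A : 'M[R]_(m, n)) :
  0 < a -> spectral_norm (a *: A) = a * spectral_norm A.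
Proof.
have le b (B : 'M[R]_(m, n)) :
    0 < b -> spectral_norm (b *: B) <= b * spectral_norm B.
  move=> b0; apply: spectral_norm_le => [|x].
    by rewrite mulr_ge0 ?spectral_norm_ge0// ltW.
  by rewrite -scalemxAl enormZ gtr0_norm// -mulrA ler_pM2l// enorm_mulmx_le.
move=> a0; apply/eqP; rewrite eq_le le//=.
rewrite -ler_pdivlMl//.
have := le a^-1 (a *: A).
by rewrite scalerA mulVf ?gt_eqF// scale1r invr_gt0; exact.
Qed.

(** By Cauchy-Schwarz, [|A^T x|^2 = <x, A A^T x> <= |x| |A| |A^T x|]; dividing
    by [|A^T x|] shows that transposing a matrix does not increase its spectral
    norm. *)
Lemma enorm_trmx_mulmx_le (R : realType) (m n : nat) (A : 'M[R]_(m, n))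
    (x : 'cV[R]_m) : enorm (A^T *m x) <= spectral_norm A * enorm x.
Proof.
set y := A^T *m x.
have [y0|y0] := eqVneq (enorm y) 0.
  by rewrite y0 mulr_ge0 ?enorm_ge0 ?spectral_norm_ge0.
have y_gt0 : 0 < enorm y by rewrite lt_def y0 enorm_ge0.
rewrite -(ler_pM2r y_gt0) -expr2 enorm_sqr_col {1}/y trmx_mul trmxK -mulmxA.
rewrite (le_trans (ler_norm _))// (le_trans (cauchy_schwarz _ _))//.
by rewrite [leRHS]mulrAC mulrC ler_wpM2r ?enorm_ge0// enorm_mulmx_le.
Qed.

(** * Taylor's inequality on a convex set *)

Lemma has_diff_withinP (R : realType) (V W : normedModType R) (Q : set V)
    (f : V -> W) (x : V) (df : V -> W) :
  has_diff_within Q f x df <->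
  (forall e : R, 0 < e -> \forall y \near nbhs x, Q y ->
     `|f y - f x - df (y - x)| <= e * `|y - x|).
Proof.
rewrite /has_diff_within; split=> [H e e0|H].
  have /eqoP/(_ e e0) := funext H; exact.
pose F := within Q (nbhs x).
suff : (fun y => f y - f x - df (y - x)) =o_F (fun y => y - x).
  by rewrite funeqE.
apply/eqoP => e e0; exact: H.
Qed.

Lemma convex_set_segment (R : realType) (V : lmodType R) (Q : set V) (x h : V)
    (t : R) :
  convex_set Q -> Q x -> Q (x + h) -> 0 <= t <= 1 -> Q (x + t *: h).
Proof.
move=> cQ Qx Qxh /andP[t0 t1].
have tI : Itv.spec (@Itv.num_sem R) (Itv.Real `[0%Z, 1%Z]) t.
  by rewrite /= /Itv.num_sem/= num_real in_itv/= t0.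
have := cQ (x + h) x (Itv.Def tI) (mem_set Qxh) (mem_set Qx).
rewrite inE /conv/= /unstable.onem scalerDr scalerBl scale1r.
by rewrite addrC addrA subrK.
Qed.

(** Relative differentiability survives restriction to a line: only increments
    staying in [Q] are tested, and those along a segment of [Q] do.  Homogeneity
    of [df] turns [df ((s - t) h)] into [(s - t) df h]. *)
Lemma has_diff_within_line (R : realType) (V W : normedModType R) (Q : set V)
    (f : V -> W) (df : V -> W) (x h : V) (I : set R) (t : R) :
  (forall s, I s -> Q (x + s *: h)) ->
  (forall (a : R) v, df (a *: v) = a *: df v) ->
  has_diff_within Q f (x + t *: h) df ->
  has_diff_within I (fun s : R^o => f (x + s *: h)) t (fun r => r *: df h).
Proof.
move=> IQ dfZ /has_diff_withinP fx; apply/has_diff_withinP => e e0.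
(* the 1 covers the case [h = 0] *)
have e'0 : 0 < e / (`|h| + 1) by rewrite divr_gt0// ltr_wpDl.
have cl : (fun s : R => x + s *: h) @ t --> x + t *: h.
  by apply: cvgD; [exact: cvg_cst|apply: cvgZr_tmp; exact: cvg_id].
have : \forall s \near t, Q (x + s *: h) ->
    `|f (x + s *: h) - f (x + t *: h) - df (x + s *: h - (x + t *: h))|
      <= e / (`|h| + 1) * `|x + s *: h - (x + t *: h)| := cl _ (fx _ e'0).
apply: (@filterS _ (nbhs t)) => s Hs Is; have := Hs (IQ s Is).
rewrite opprD addrACA subrr add0r -scalerBl dfZ => /le_trans; apply.
rewrite normrZ mulrCA [leRHS]mulrC ler_wpM2l// mulrAC ler_pdivrMr ?ltr_wpDl//.
by rewrite ler_wpM2l ?ltW// ltrDl.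
Qed.

(** The estimate of the increment for [e = 1] makes [p] Lipschitz at [t], with
    constant [1 + |d|], near [t] in [I]. *)
Lemma has_diff_within_cvg (R : realType) (I : set R) (p : R -> R) (t d : R) :
  has_diff_within I (p : R^o -> R^o) t (fun r => r * d) ->
  p @ within I (nbhs t) --> p t.
Proof.
move=> /has_diff_withinP/(_ 1 ltr01) pt.
apply/cvgrPdist_le => e e0; rewrite near_withinE.
have e'0 : 0 < e / (1 + `|d|) by rewrite divr_gt0// ltr_pwDl.
near=> s => Is.
have : `|s - t| <= e / (1 + `|d|).
  near: s; have /= := nbhsx_ballx t _ e'0.
  by apply: filterS => s /= /ltW; rewrite distrC.
rewrite ler_pdivlMr ?ltr_pwDl// mulrDr mulr1 -normrM => /(le_trans _); apply.
have : `|p s - p t - (s - t) * d| <= 1 * `|s - t|.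
  by move: Is; near: s.
rewrite mul1r => ps; rewrite distrC -[p s - p t](subrK ((s - t) * d)).
by rewrite (le_trans (ler_normD _ _))// lerD2r.
Unshelve. all: by end_near. Qed.

(** At an interior point of [I] every small increment stays in [I], so the
    relative derivative is the usual one. *)
Lemma has_diff_within_is_derive (R : realType) (I : set R) (p : R -> R)
    (t d : R) : I° t ->
  has_diff_within I (p : R^o -> R^o) t (fun r => r * d) ->
  is_derive t 1 p d.
Proof.
move=> It /has_diff_withinP pt.
have cv : (fun h => h^-1 *: ((p \o shift t) (h *: 1) - p t)) @ 0^' --> d.
  apply/cvgrPdist_le => e e0.
  have pe : \forall s \near t, `|p s - p t - (s - t) * d| <= e * `|s - t|.
    have := pt _ e0; move: It; rewrite /interior => It.
    by apply: (@filterS2 _ (nbhs t)) It => s Is; apply.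
  have sh : (fun h : R => h + t) @ 0^' --> t.
    rewrite -[X in _ --> X]add0r; apply: cvgD; last exact: cvg_cst.
    exact: (@cvg_within _ (nbhs (0 : R))).
  near=> h.
  have h0 : h != 0 by near: h; exact: nbhs_dnbhs_neq.
  have : `|p (h + t) - p t - (h + t - t) * d| <= e * `|h + t - t|.
    by near: h; exact: (sh _ pe).
  rewrite addrK /= => ph.
  have -> : d - h^-1 *: (p (h *: 1 + t) - p t)
      = - (h^-1 * (p (h + t) - p t - h * d)).
    by rewrite /GRing.scale/= mulr1; field.
  rewrite normrN normrM normfV ler_pdivrMl ?normr_gt0//.
  by rewrite [leRHS]mulrC.
by split; [apply/cvg_ex; exists d|exact/cvg_lim].
Unshelve. all: by end_near. Qed.

(** The mean value theorem for [p t + a t^2].  The quadratic term makes it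
    possible to compensate a linear growth of the derivative [d] of [p]. *)
Lemma MVT_quadratic (R : realType) (p d : R -> R) (a : R) :
  (forall t : R, 0 <= t <= 1 ->
    has_diff_within (`[0, 1] : set R) (p : R^o -> R^o) t (fun r => r * d t)) ->
  exists2 c, 0 <= c <= 1 & p 1 - p 0 + a = d c + 2 * a * c.
Proof.
move=> pd.
have [| |c c01] := @MVT R (fun t => p t + a * t ^+ 2)
  (fun t => d t + 2 * a * t) 0 1 ltr01.
- move=> t t01.
  have t01' : 0 <= t <= 1.
    by move: t01; rewrite in_itv/= => /andP[/ltW-> /ltW->].
  have It : (`[0, 1] : set R)° t.
    by rewrite interior_itv_bnd/=.
  have pt := has_diff_within_is_derive It (pd t t01').
  apply: is_derive_eq.
  by rewrite /GRing.scale/=; ring.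
- apply/subspace_continuousP => t /=; rewrite in_itv/= => t01.
  apply: cvgD; first exact: has_diff_within_cvg (pd t t01).
  apply: cvg_within_filter.
  by apply: cvgM; [exact: cvg_cst|exact: exprn_continuous].
rewrite subr0 mulr1 expr1n expr0n/= mulr1 mulr0 addr0 => E.
exists c; first by move: c01; rewrite in_itv/= => /andP[/ltW-> /ltW->].
by rewrite -E addrAC.
Qed.

(** Adding [- K t^2 / 2] to [p] turns the derivative at the mean value point [c]
    into [d c - K c], which is at most [d 0]; adding [K t^2 / 2] gives the lower
    bound. *)
Lemma taylor_bound01 (R : realType) (p d : R -> R) (K : R) :
  (forall t : R, 0 <= t <= 1 ->
    has_diff_within (`[0, 1] : set R) (p : R^o -> R^o) t (fun r => r * d t)) ->
  (forall t, 0 <= t <= 1 -> `|d t - d 0| <= K * t) ->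
  `|p 1 - p 0 - d 0| <= K / 2.
Proof.
move=> pd dK; rewrite ler_norml; apply/andP; split.
  have [c /dK] := MVT_quadratic (K / 2) pd.
  by rewrite ler_norml => /andP[+ _] E; lra.
have [c /dK] := MVT_quadratic (- (K / 2)) pd.
by rewrite ler_norml => /andP[_ +] E; lra.
Qed.

(** Along the segment the derivative of [f] at time [t] differs from its value
    at [0] by [<grad f (x + t h) - grad f x, h>], at most [L t |h|^2] by
    Cauchy-Schwarz and the Lipschitz condition. *)
Lemma taylor_bound (R : realType) (n : nat) (Q : set 'cV[R]_n)
    (f : 'cV[R]_n -> R) (L : R) (x h : 'cV[R]_n) :
  convex_set Q ->
  (forall x, Q x -> exists g, has_gradient_within Q f x g) ->
  lipschitz_gradient_on Q f L -> Q x -> Q (x + h) ->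
  `|f (x + h) - f x - ((gradient Q f x)^T *m h) 0 0| <= L / 2 * enorm h ^+ 2.
Proof.
move=> cQ df Lf Qx Qxh.
have Qt t : 0 <= t <= 1 -> Q (x + t *: h) by exact: convex_set_segment.
pose p (t : R) := f (x + t *: h).
pose d (t : R) := ((gradient Q f (x + t *: h))^T *m h) 0 0.
have pd t : 0 <= t <= 1 ->
    has_diff_within (`[0, 1] : set R) (p : R^o -> R^o) t (fun r => r * d t).
  move=> /Qt Qxt.
  pose df' (v : 'cV[R]_n) : R := ((gradient Q f (x + t *: h))^T *m v) 0 0.
  apply: (@has_diff_within_line R _ R^o Q f df' x h `[0, 1] t) => [s|a v|].
  - by rewrite /= in_itv/=; exact: Qt.
  - by rewrite /df' -scalemxAr mxE.
  - exact: (getPex (df _ Qxt)).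
have dK t : 0 <= t <= 1 -> `|d t - d 0| <= L * enorm h ^+ 2 * t.
  move=> t01.
  have -> : d t - d 0 =
      ((gradient Q f (x + t *: h) - gradient Q f (x + 0 *: h))^T *m h) 0 0.
    by rewrite /d [(_ - _)^T]linearB/= mulmxBl [RHS]mxE [X in _ = _ + X]mxE.
  rewrite (le_trans (cauchy_schwarz _ _))//.
  have := Lf _ _ (Qt t t01) (Qt 0 _); rewrite lexx ler01 => /(_ isT).
  have [t0 _] := andP t01.
  rewrite opprD addrACA subrr add0r -scalerBl subr0 enormZ ger0_norm// => Lh.
  apply: le_trans (ler_wpM2r (enorm_ge0 h) Lh) _.
  by rewrite le_eqVlt; apply/orP; left; apply/eqP; ring.
have := taylor_bound01 pd dK.
by rewrite /p /d scale1r scale0r addr0 mulrAC.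
Qed.

(** * The square column bound and the delta bound *)

Lemma radius_ge (R : realType) (n : nat) (u : 'I_n.+1 -> 'cV[R]_n) (j : 'I_n) :
  enorm (u (lift ord0 j) - u ord0) <= Defs.radius u.
Proof. exact: (le_bigmax 0 (fun j => enorm (u j - u ord0))). Qed.

Lemma radius_equally_distant (R : realType) (n : nat)
    (u : 'I_n.+1 -> 'cV[R]_n) (j : 'I_n) : equally_distant u ->
  enorm (u (lift ord0 j) - u ord0) = Defs.radius u.
Proof.
move=> eqd; apply/eqP; rewrite eq_le radius_ge/=.
apply: bigmax_le => [|k _]; first exact: enorm_ge0.
case: (unliftP ord0 k) => [i|] ->; first by rewrite (eqd i j).
by rewrite subrr enorm0 enorm_ge0.
Qed.

(** If the first column of [U] vanished, [U] could not be invertible. *)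
Lemma radius_gt0 (R : realType) (n : nat) (u : 'I_n.+1 -> 'cV[R]_n) :
  (0 < n)%N -> poised u -> 0 < Defs.radius u.
Proof.
case: n u => // n u _ Uu.
apply: lt_le_trans (radius_ge u ord0).
rewrite lt_def enorm_ge0 andbT enorm_eq0; apply/eqP => c0.
have Ue : simplex_matrix u *m delta_mx ord0 0 = 0 :> 'cV_n.+1.
  rewrite -colE -c0.
  by apply/matrixP => i j; rewrite !mxE !ord1.
have /matrixP/(_ ord0 0) := congr1 (mulmx (invmx (simplex_matrix u))) Ue.
by rewrite mulKmx// mulmx0 !mxE !eqxx => /eqP; rewrite oner_eq0.
Qed.

Lemma spectral_norm_invmx_gt0 (R : realType) (n : nat) (A : 'M[R]_n) :
  (0 < n)%N -> A \in unitmx -> 0 < spectral_norm (invmx A).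
Proof.
case: n A => // n A _ UA.
apply: (@spectral_norm_gt0 _ _ _ _ (A *m delta_mx ord0 (0 : 'I_1))).
rewrite mulKmx//; apply/eqP => /matrixP/(_ ord0 0).
by rewrite !mxE !eqxx => /eqP; rewrite oner_eq0.
Qed.

(** Scaling [U] by [1 / Delta] multiplies the norm of its inverse by [Delta];
    the bound then differs from the square column bound in a single factor. *)
Lemma delta_boundE (R : realType) (n : nat) (u : 'I_n.+1 -> 'cV[R]_n) (L : R) :
  (0 < n)%N -> poised u ->
  delta_bound u L = L / 2 * (Num.sqrt n%:R * Defs.radius u ^+ 2)
    * spectral_norm (invmx (simplex_matrix u)).
Proof.
move=> n0 Uu; have r0 := radius_gt0 n0 Uu.
rewrite /delta_bound /scaled_simplex_matrix invmxZ; last first.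
  by rewrite unitmxZ// unitfE invr_eq0 gt_eqF.
by rewrite invrK spectral_normZ//; ring.
Qed.

Definition squared_distances (R : realType) (n : nat)
    (u : 'I_n.+1 -> 'cV[R]_n) : 'rV[R]_n :=
  \row_j enorm (u (lift ord0 j) - u ord0) ^+ 2.

Lemma square_column_boundE (R : realType) (n : nat) (u : 'I_n.+1 -> 'cV[R]_n)
    (L : R) :
  square_column_bound u L = L / 2 * enorm (squared_distances u)
    * spectral_norm (invmx (simplex_matrix u)).
Proof.
by congr (_ * enorm _ * _); apply/rowP => j; rewrite !mxE enorm_sqr_col mxE.
Qed.

Lemma enorm_const_row (R : realType) (n : nat) (a : R) :
  0 <= a -> enorm (const_mx a : 'rV[R]_n) = Num.sqrt n%:R * a.
Proof.
move=> a0; rewrite /enorm big_ord1.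
under eq_bigr do rewrite mxE.
rewrite sumr_const card_ord -[_ ^+ 2 *+ n]mulr_natl sqrtrM ?ler0n//.
by rewrite sqrtr_sqr ger0_norm.
Qed.

(** Both sides are, after squaring, sums of [n] fourth powers that compare term
    by term; equality of the sums forces equality of all the terms. *)
Lemma enorm_squared_distances (R : realType) (n : nat)
    (u : 'I_n.+1 -> 'cV[R]_n) :
  enorm (squared_distances u) <= Num.sqrt n%:R * Defs.radius u ^+ 2
    ?= iff [forall j, enorm (u (lift ord0 j) - u ord0) == Defs.radius u].
Proof.
have r0 : 0 <= Defs.radius u by apply: bigmax_ge_id.
rewrite -enorm_const_row ?sqr_ge0//.
rewrite -(mono_in_leif ler_sqr) ?nnegrE ?enorm_ge0// !enorm_sqr !big_ord1.
apply: leif_sum => j _; rewrite !mxE.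
rewrite !(mono_in_leif ler_sqr) ?nnegrE ?sqr_ge0 ?enorm_ge0//.
exact/leif_eq/radius_ge.
Qed.

(** The [j]-th entry of [r = U^T (g_t - grad f u_0)] is the linearization error
    of [f] between [u_0] and [u_j], which Taylor's inequality bounds by
    [L / 2 * |u_j - u_0|^2]; the error of the gradient is [U^-T r]. *)
Lemma simplex_gradient_error (R : realType) (n : nat) (Q : set 'cV[R]_n)
    (f : 'cV[R]_n -> R) (L : R) (u : 'I_n.+1 -> 'cV[R]_n) :
  convex_set Q ->
  (forall x, Q x -> exists g, has_gradient_within Q f x g) ->
  0 <= L ->
  lipschitz_gradient_on Q f L ->
  (forall j, Q (u j)) ->
  poised u ->
  enorm (simplex_gradient u f - gradient Q f (u ord0))
    <= square_column_bound u L.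
Proof.
move=> cQ df L0 Lf Qu Uu.
set U := simplex_matrix u; set g := gradient Q f (u ord0).
pose r := (\row_j (f (u (lift ord0 j)) - f (u ord0)))^T - U^T *m g.
have -> : simplex_gradient u f - g = (invmx U)^T *m r.
  rewrite mulmxBr; congr (_ - _).
  by rewrite mulmxA -trmx_mul mulmxV// trmx1 mul1mx.
have rL : enorm r <= L / 2 * enorm (squared_distances u).
  rewrite -[L / 2]ger0_norm ?divr_ge0// -enormZ -[X in _ <= X]enorm_tr.
  apply: ler_enorm => j k; rewrite !ord1 !mxE.
  have -> : \sum_i U^T j i * g i 0 = (g^T *m (u (lift ord0 j) - u ord0)) 0 0.
    by rewrite mxE; apply: eq_bigr => i _; rewrite !mxE mulrC.
  set h := _ - u ord0.
  have := @taylor_bound _ _ _ _ _ _ h cQ df Lf (Qu ord0).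
  by rewrite /h addrCA subrr addr0; apply; exact: Qu.
rewrite square_column_boundE.
rewrite (le_trans (enorm_trmx_mulmx_le _ _))// mulrC.
by rewrite ler_wpM2r ?spectral_norm_ge0.
Qed.

Theorem corollary3 (R : realType) (n : nat) (n_gt0 : (0 < n)%N)
    (Q : set 'cV[R]_n) (f : 'cV[R]_n -> R) (L : R)
    (u : 'I_n.+1 -> 'cV[R]_n) :
  convex_set Q ->
  twice_continuously_differentiable_on Q f ->
  0 <= L ->
  lipschitz_gradient_on Q f L ->
  (forall j, Q (u j)) ->
  poised u ->
  [/\ enorm (simplex_gradient u f - gradient Q f (u ord0))
        <= square_column_bound u L,
      square_column_bound u L <= delta_bound u L,
      equally_distant u -> square_column_bound u L = delta_bound u L &
      0 < L -> square_column_bound u L = delta_bound u L -> equally_distant u].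
Proof.
move=> cQ [df _] L0 Lf Qu Uu.
have s0 := spectral_norm_invmx_gt0 n_gt0 Uu.
have [le_d eq_d] := enorm_squared_distances u.
rewrite delta_boundE//; split; first exact: simplex_gradient_error.
- by rewrite square_column_boundE ler_wpM2r ?(ltW s0)// ler_wpM2l ?divr_ge0.
- move=> eqd; rewrite square_column_boundE; congr (_ * _ * _); apply/eqP.
  by rewrite eq_d; apply/forallP => j; rewrite radius_equally_distant.
- rewrite square_column_boundE => L_gt0.
  move/(mulIf (lt0r_neq0 s0)).
  move/(mulfI (lt0r_neq0 (divr_gt0 L_gt0 (ltr0Sn _ 1))))/eqP.
  by rewrite eq_d => /forallP d j k; rewrite (eqP (d j)) (eqP (d k)).
Qed.
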